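(* Let $\mathfrak G=(X,1,\curlywedge,s,A)$ and $\mathfrak G'=(X',1',\curlywedge',s',A')$ be general selection L-frames with admissible valuations $V,V'$, and let $f$ be a selection model morphism from $\mathfrak M=(\mathfrak G,V)$ to $\mathfrak M'=(\mathfrak G',V')$. Then for all $x\in X$ and every formula $\phi$: $\mathfrak M,x\Vdash\phi$ if and only if $\mathfrak M',f(x)\Vdash\phi$.
   Context: Formulas: $\phi::=p\mid\top\mid\bot\mid\phi\wedge\phi\mid\phi\vee\phi\mid\phi\Rightarrow\phi$. Meet-semilattice $(X,1,\curlywedge)$, $x\preccurlyeq y$ iff $x\curlywedge y=x$; filters are upward closed subsets closed under finite meets; $\mathcal F(X)$ the filters; $p\sqcup q:={\uparrow}\{x\curlywedge y:x\in p,y\in q\}$. A general selection L-frame is $(X,1,\curlywedge,s,A)$ where $A\subseteq\mathcal F(X)$ contains $X,\{1\}$ and is closed under $\cap$, $\sqcup$ and $a\Rightarrow b:=\{x: s(x,a)\subseteq b\}$, and $s:X\times A\to\mathcal F(X)$ satisfies for all $a\in A$: $s(1,a)=\{1\}$; $x\preccurlyeq y\Rightarrow s(y,a)\subseteq s(x,a)$; if $z\in s(x\curlywedge y,a)$ there are $u\in s(x,a)$, $v\in s(y,a)$ with $u\curlywedge v\preccurlyeq z$. An admissible valuation maps letters into $A$. Truth: $x\Vdash p$ iff $x\in V(p)$; $\top$ always; $x\Vdash\bot$ iff $x=1$; $\wedge$ pointwise; $x\Vdash\phi\vee\psi$ iff there are $y\Vdash\phi$, $z\Vdash\psi$ with $y\curlywedge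 z\preccurlyeq x$; $x\Vdash\phi\Rightarrow\psi$ iff $s(x,[\![\phi]\!])\subseteq[\![\psi]\!]$. An L-morphism is a semilattice homomorphism $f:X\to X'$ with $f(x)=1'$ iff $x=1$, and such that if $y'\curlywedge' z'\preccurlyeq' f(x)$ there are $y,z\in X$ with $y'\preccurlyeq' f(y)$, $z'\preccurlyeq' f(z)$, $y\curlywedge z\preccurlyeq x$. A selection morphism $\mathfrak G\to\mathfrak G'$ is an L-morphism $f$ such that for all $x\in X$, $a'\in A'$: $f^{-1}(a')\in A$; if $y\in s(x,f^{-1}(a'))$ then $f(y)\in s'(f(x),a')$; if $y'\in s'(f(x),a')$ there is $y\in s(x,f^{-1}(a'))$ with $f(y)\preccurlyeq' y'$. A selection model morphism $(\mathfrak G,V)\to(\mathfrak G',V')$ is a selection morphism with $V(p)=f^{-1}(V'(p))$ for all letters $p$. *)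

(* Defs.v *)
From mathcomp Require Import all_boot all_order.
From mathcomp Require Import boolp classical_sets.

Set Implicit Arguments.
Unset Strict Implicit.
Unset Printing Implicit Defensive.

Local Open Scope classical_set_scope.
Local Open Scope order_scope.

Inductive formula (P : Type) : Type :=
| Letter of P
| Top
| Bot
| And of formula P & formula P
| Or of formula P & formula P
| Imp of formula P & formula P.
Arguments Top {P}.
Arguments Bot {P}.

Section Filters.
Context {d : Order.disp_t} {X : tMeetSemilatticeType d}.
Implicit Types (p q : set X) (x y : X).

(* The unit 1 of the semilattice is [\top]; as the empty meet it lies in every
   filter. *)
Definition is_filter p : Prop :=
  [/\ forall x y, p x -> x <= y -> p y,
      p \top &
      forall x y, p x -> p y -> p (x `&` y)%O].

Definition upclosure p : set X := [set y | exists2 x, p x & x <= y].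

Definition filter_join p q : set X :=
  upclosure [set (x `&` y)%O | x in p & y in q].

Definition sel_imp (s : X -> set X -> set X) p q : set X :=
  [set x | s x p `<=` q].

End Filters.

(* A map s : X * A -> F(X) is encoded as a total function on [X * set X] about
   which nothing is assumed outside A. *)
Record general_selection_frame (d : Order.disp_t) (X : tMeetSemilatticeType d)
    : Type := GeneralSelectionFrame {
  sel : X -> set X -> set X;
  adm : set (set X);
  adm_filter : forall a, adm a -> is_filter a;
  adm_setT : adm [set: X];
  adm_set1 : adm [set \top];
  adm_setI : forall a b, adm a -> adm b -> adm (a `&` b)%classic;
  adm_join : forall a b, adm a -> adm b -> adm (filter_join a b);
  adm_imp : forall a b, adm a -> adm b -> adm (sel_imp sel a b);
  sel_filter : forall x a, adm a -> is_filter (sel x a);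
  sel_top : forall a, adm a -> sel \top a = [set \top];
  sel_anti : forall a x y, adm a -> x <= y -> sel y a `<=` sel x a;
  sel_meet : forall a x y z, adm a -> sel (x `&` y)%O a z ->
    exists u v, [/\ sel x a u, sel y a v & (u `&` v)%O <= z]
}.

Record valuation (P : Type) (d : Order.disp_t) (X : tMeetSemilatticeType d)
    (G : general_selection_frame X) : Type := Valuation {
  val_set :> P -> set X;
  val_adm : forall p, adm G (val_set p)
}.

(* [forces V phi] is also the truth set of phi. *)
Fixpoint forces (P : Type) (d : Order.disp_t) (X : tMeetSemilatticeType d)
    (G : general_selection_frame X) (V : valuation P G) (phi : formula P)
    (x : X) {struct phi} : Prop :=
  match phi with
  | Letter p => V p x
  | Top => True
  | Bot => x = \top
  | And phi1 phi2 => forces V phi1 x /\ forces V phi2 x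
  | Or phi1 phi2 => exists y z,
      [/\ forces V phi1 y, forces V phi2 z & (y `&` z)%O <= x]
  | Imp phi1 phi2 =>
      sel G x [set y | forces V phi1 y] `<=` [set y | forces V phi2 y]
  end.

Section Morphisms.
Context {d d' : Order.disp_t}.
Context {X : tMeetSemilatticeType d} {X' : tMeetSemilatticeType d'}.
Implicit Type f : X -> X'.

Definition semilattice_hom f : Prop :=
  f \top = \top /\ forall x y, f (x `&` y)%O = (f x `&` f y)%O.

Definition L_morphism f : Prop :=
  [/\ semilattice_hom f,
      forall x, f x = \top <-> x = \top &
      forall x y' z', (y' `&` z')%O <= f x ->
        exists y z, [/\ y' <= f y, z' <= f z & (y `&` z)%O <= x]].

Definition selection_morphism (G : general_selection_frame X)
    (G' : general_selection_frame X') f : Prop :=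
  L_morphism f /\
  forall x a', adm G' a' ->
    [/\ adm G (f @^-1` a'),
        forall y, sel G x (f @^-1` a') y -> sel G' (f x) a' (f y) &
        forall y', sel G' (f x) a' y' ->
          exists2 y, sel G x (f @^-1` a') y & f y <= y'].

Definition selection_model_morphism (P : Type)
    (G : general_selection_frame X) (V : valuation P G)
    (G' : general_selection_frame X') (V' : valuation P G') f : Prop :=
  selection_morphism G G' f /\ forall p, V p = f @^-1` (V' p).

End Morphisms.

(* Main.v *)
(* Induction on the formula. For an implication the induction hypothesis says
   that the truth set of the antecedent in the source is the preimage of its
   truth set in the target; the latter is admissible, so the back-and-forth
   conditions on the selection functions apply to it. Truth sets are moreover
   filters, hence upward closed, which absorbs the inequalities in the back
   conditions for disjunction and implication. *)
Require Import Defs.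
From mathcomp Require Import all_boot all_order.
From mathcomp Require Import classical_sets.

Import Order.TTheory.
Local Open Scope order_scope.
Local Open Scope classical_set_scope.

(** Each connective is matched by a closure condition on [adm G]; the truth set of a disjunction is
    the [filter_join] of those of its disjuncts. *)
Lemma adm_forces (P : Type) (d : Order.disp_t) (X : tMeetSemilatticeType d)
    (G : general_selection_frame X) (V : valuation P G) (phi : formula P) :
  adm G [set x | forces V phi x].
Proof.
elim: phi => [p| | |phi1 IH1 phi2 IH2|phi1 IH1 phi2 IH2|phi1 IH1 phi2 IH2] /=.
- exact: val_adm.
- exact: adm_setT.
- exact: adm_set1.
- exact: adm_setI.
- have -> : [set x | exists y z,
      [/\ forces V phi1 y, forces V phi2 z & (y `&` z)%O <= x]] =
      filter_join [set x | forces V phi1 x] [set x | forces V phi2 x].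
    apply/seteqP; split => x /=.
      move=> [y [z [hy hz le]]]; exists (y `&` z)%O => //.
      by exists y => //; exists z.
    by move=> [_ [y hy [z hz <-]] le]; exists y, z.
  exact: adm_join.
- exact: adm_imp.
Qed.

Arguments adm_forces {P d X G} V phi.

Lemma forces_le (P : Type) (d : Order.disp_t) (X : tMeetSemilatticeType d)
    (G : general_selection_frame X) (V : valuation P G) (phi : formula P)
    (x y : X) :
  x <= y -> forces V phi x -> forces V phi y.
Proof.
move=> le hx; have [up _ _] := adm_filter (adm_forces V phi).
exact: up hx le.
Qed.

Arguments forces_le {P d X G V phi x y}.

Theorem theorem3p23 (P : Type) (d d' : Order.disp_t)
    (X : tMeetSemilatticeType d) (X' : tMeetSemilatticeType d')
    (G : general_selection_frame X) (G' : general_selection_frame X')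
    (V : valuation P G) (V' : valuation P G') (f : X -> X')
    (hf : selection_model_morphism V V' f) (x : X) (phi : formula P) :
  forces V phi x <-> forces V' phi (f x).
Proof.
case: hf => -[[[_ fI] f1 f_split] f_sel] fV.
(* The point stays general, since disjunction and implication refer to other points. *)
elim: phi x => [p| | |phi1 IH1 phi2 IH2|phi1 IH1 phi2 IH2|phi1 IH1 phi2 IH2] x /=.
- by rewrite fV.
- by [].
- by split=> /f1.
- by rewrite IH1 IH2.
- split=> [[y [z [/IH1 hy /IH2 hz le]]]|[y' [z' [hy hz le]]]].
    exists (f y), (f z); split=> //.
    (* [f] is monotone because it preserves meets: [le] makes the meet of [y] and [z] absorb [x]. *)
    by rewrite -fI -(meet_idPl le) fI leIr.
  have [y [z [ley lez leyz]]] := f_split _ _ _ le.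
  exists y, z; split=> //.
    exact/IH1/(forces_le ley).
  exact/IH2/(forces_le lez).
- have -> : [set y | forces V phi1 y] = f @^-1` [set y | forces V' phi1 y].
    by apply/seteqP; split=> y /IH1.
  have [_ forth back] := f_sel x _ (adm_forces V' phi1).
  split=> sub.
    move=> y' /back [y /sub /IH2 hy le].
    exact: forces_le le hy.
  by move=> y /forth /sub /IH2.
Qed.
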